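(* Let $L$ be a non-null Lagrangian surface of $(T\mathbb{R}^2,\mathbb{J},\mathbb{G},\Omega)\simeq\mathbb{R}^{2,2}$ with Lagrangian angle $\beta$. Then $$\vec H=\tfrac12\,\mathbb{J}D\beta,$$ where $\vec H$ is the mean curvature vector of $L$ and $D\beta$ is the gradient of $\beta$ with respect to the induced pseudo-metric on $L$. In particular, a non-null Lagrangian surface is minimal if and only if its Lagrangian angle is locally constant.
   Context: On $T\mathbb{R}^2\simeq\mathbb{R}^4$ with base coordinates $(x_1,x_2)$ and fibre coordinates $(y_1,y_2)$, let $\Omega=dy_1\wedge dx_1+dy_2\wedge dx_2$, let $\mathbb{J}=j\oplus j$ with $j(x_1,x_2)=(-x_2,x_1)$ acting on both the $x$- and $y$-components, and let $\mathbb{G}(X,Y)=\Omega(\mathbb{J}X,Y)$, a flat pseudo-metric of signature $(2,2)$. $\mathbb{J}$ identifies $T\mathbb{R}^2$ with $\mathbb{C}^2$ via $w_1=x_1+ix_2$, $w_2=y_1+iy_2$. A surface $L$ (smooth, immersed) is Lagrangian if $\Omega$ restricts to zero on it, and non-null if the metric induced by $\mathbb{G}$ is non-degenerate. The Lagrangian angle $\beta(p)$ of such an $L$ at $p$ is the argument of the nonzero complex number $dw_1\wedge dw_2(e_1,e_2)=\det_{\mathbb{C}}(e_1,e_2)$, where $(e_1,e_2)$ is a basis of $T_pL$; it is defined modulo $\pi$ (modulo $2\pi$ if $L$ is oriented), so that its differential is well defined. The mean curvature vector $\vec H$ is one half of the trace, with respect to the induced metric, of the second fundamental form of $L$ in $(T\mathbb{R}^2,\mathbb{G})$;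 $L$ is minimal if $\vec H=0$. *)

(* Defs.v *)
From HB Require Import structures.
From mathcomp Require Import all_boot all_order all_algebra.
From mathcomp Require Import all_classical all_reals all_analysis.
From mathcomp Require Import complex.

Set Implicit Arguments.
Unset Strict Implicit.
Unset Printing Implicit Defensive.

Import Order.TTheory GRing.Theory Num.Theory numFieldNormedType.Exports.

Local Open Scope classical_set_scope.
Local Open Scope ring_scope.
Local Open Scope complex_scope.

(* The tangent bundle of the plane; X.1 holds the base coordinates (x_1, x_2)
   and X.2 the fibre coordinates (y_1, y_2). *)
Notation TR2 R := ('rV[R]_2 * 'rV[R]_2)%type.

Section AmbientStructures.
Variable R : realType.
Implicit Types (v : 'rV[R]_2) (X Y : TR2 R).

(* dy_1 /\ dx_1 + dy_2 /\ dx_2, with (a /\ b)(X, Y) = a(X) b(Y) - b(X) a(Y) *)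
Definition Omega X Y : R :=
  \sum_(k < 2) (X.2 0 k * Y.1 0 k - X.1 0 k * Y.2 0 k).

Definition jrot v : 'rV[R]_2 := \row_k (if k == 0 then - v 0 1 else v 0 0).

Definition JJ X : TR2 R := (jrot X.1, jrot X.2).

Definition GG X Y : R := Omega (JJ X) Y.

Definition w1 X : R[i] := X.1 0 0 +i* X.1 0 1.
Definition w2 X : R[i] := X.2 0 0 +i* X.2 0 1.

Definition dw1w2 X Y : R[i] := w1 X * w2 Y - w2 X * w1 Y.

End AmbientStructures.

Section Smoothness.
Variables (R : realType) (V W : normedModType R).

(* Meaningful on open sets U, where it is the usual C^n regularity. *)
Fixpoint Cn_on (n : nat) (U : set V) (f : V -> W) : Prop :=
  if n is m.+1 then
    (forall x, U x -> differentiable f x) /\ (forall v, Cn_on m U ('D_v f))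
  else forall x, U x -> {for x, continuous f}.

Definition smooth_on (U : set V) (f : V -> W) : Prop := forall n, Cn_on n U f.

End Smoothness.

(* Abstract smooth 2-manifolds.  [chart i] is only meaningful on [dom i], and
   its inverse [par i] (a local parametrization) on [chart i @` dom i]. *)
Record surface (R : realType) := Surface {
  carrier :> topologicalType ;
  surface_hausdorff : hausdorff_space carrier ;
  surface_second_countable : @second_countable carrier ;
  atlas : Type ;
  dom : atlas -> set carrier ;
  chart : atlas -> carrier -> 'rV[R]_2 ;
  par : atlas -> 'rV[R]_2 -> carrier ;
  dom_open : forall i, open (dom i) ;
  chart_open : forall i, open (chart i @` dom i) ;
  chartK : forall i p, dom i p -> par i (chart i p) = p ;
  chart_continuous :
    forall i p, dom i p -> {for p, continuous (chart i)} ;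
  par_continuous :
    forall i p, dom i p -> {for chart i p, continuous (par i)} ;
  dom_cover : forall p, exists i, dom i p ;
  transition_smooth : forall i j,
    smooth_on (chart i @` (dom i `&` dom j)) (chart j \o par i)
}.

Section ParametrizedSurface.
Variable R : realType.

Definition partial (W : normedModType R) (a : 'I_2) (f : 'rV[R]_2 -> W) :
    'rV[R]_2 -> W :=
  'D_(delta_mx 0 a) f.

Implicit Types (f : 'rV[R]_2 -> TR2 R) (u : 'rV[R]_2).

Definition tangent f u : {vspace TR2 R} :=
  <<[:: (partial 0 f u)%R; (partial 1 f u)%R]>>%VS.

Definition metric f u : 'M[R]_2 :=
  \matrix_(a, b) GG (partial a f u) (partial b f u).

Definition cometric f u : 'M[R]_2 := invmx (metric f u).

(* GG-orthogonal projections; relevant when [metric f u] is invertible. *)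
Definition tangential f u (Z : TR2 R) : TR2 R :=
  \sum_a \sum_b (cometric f u a b * GG Z (partial a f u)) *: partial b f u.

Definition normal f u (Z : TR2 R) : TR2 R := Z - tangential f u Z.

(* As the ambient connection is flat, the second fundamental form on the
   coordinate fields is the normal part of the second derivatives. *)
Definition second_ff f u (a b : 'I_2) : TR2 R :=
  normal f u (partial a (partial b f) u).

Definition mean_curvature f u : TR2 R :=
  2^-1 *: \sum_a \sum_b cometric f u a b *: second_ff f u a b.

Definition gradient f (h : 'rV[R]_2 -> R) u : TR2 R :=
  \sum_a \sum_b (cometric f u a b * partial a h u) *: partial b f u.

End ParametrizedSurface.

(* A map F on an abstract surface M is studied through its local
   parametrizations F \o par i. *)
Section ImmersedSurface.
Variables (R : realType) (M : surface R) (F : M -> TR2 R).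
Implicit Types (p q : M) (i : atlas M).

Definition tangent_at i p : {vspace TR2 R} :=
  tangent (F \o par i) (chart i p).

Definition immersion : Prop := forall i,
  smooth_on (chart i @` dom i) (F \o par i) /\
  forall p, dom i p ->
    free [:: partial 0 (F \o par i) (chart i p);
             partial 1 (F \o par i) (chart i p)].

Definition lagrangian : Prop := forall i p, dom i p ->
  forall X Y, X \in tangent_at i p -> Y \in tangent_at i p -> Omega X Y = 0.

Definition non_null : Prop := forall i p, dom i p ->
  forall X, X \in tangent_at i p ->
    (forall Y, Y \in tangent_at i p -> GG X Y = 0) -> X = 0.

Definition mean_curvature_at i p : TR2 R :=
  mean_curvature (F \o par i) (chart i p).

Definition gradient_at i (h : M -> R) p : TR2 R :=
  gradient (F \o par i) (h \o par i) (chart i p).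

Definition minimal : Prop := forall i p, dom i p -> mean_curvature_at i p = 0.

(* b is one of the real values of the Lagrangian angle at p.  All bases of the
   tangent plane, of either orientation, are allowed: on a Lagrangian non-null
   surface such b form exactly one class modulo pi. *)
Definition angle_value p (b : R) : Prop :=
  exists i e1 e2 (rho : R),
    [/\ dom i p, basis_of (tangent_at i p) [:: e1; e2], 0 < rho
      & dw1w2 e1 e2 = rho%:C * (cos b +i* sin b)].

(* beta is a differentiable real-valued determination of the Lagrangian angle
   in a neighbourhood of p. *)
Definition angle_near p (beta : M -> R) : Prop :=
  \forall q \near p, angle_value q (beta q) /\
    forall i, dom i q -> differentiable (beta \o par i) (chart i q).

Definition angle_locally_constant : Prop :=
  forall p, exists b, \forall q \near p, angle_value q b.

End ImmersedSurface.

(* Main.v *)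
(** Let [h = Omega - i GG], a Hermitian form on C^2 (up to the factor [i]).
    Cauchy-Binet gives
    [h(X,A) h(Y,B) - h(X,B) h(Y,A) = dw1w2(X,Y) conj(dw1w2(A,B))], so on a
    Lagrangian frame [e0, e1], where [h] reduces to [-i g], we get
    [det g = -|theta|^2] with [theta = dw1w2(e0, e1)]; in particular
    [theta <> 0] on a non-null surface.  The same identity, applied to the
    derivatives of the frame, yields
    [d_c beta = Im (d_c theta / theta) = \sum g^ab Omega(d_c e_a, e_b)].
    The tensor [Omega(d_a d_b f, d_c f)] is totally symmetric, by equality of
    mixed derivatives and by differentiating [Omega(e0, e1) = 0].  Hence [H] and
    [J grad beta / 2] have the same products with [e_c] (namely 0) and with
    [J e_c], and these four vectors span. *)

Require Import Defs.
From HB Require Import structures.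
From mathcomp Require Import all_boot all_order all_algebra.
From mathcomp Require Import all_classical all_reals all_analysis.
From mathcomp Require Import complex ring lra.
Import Order.TTheory GRing.Theory Num.Theory numFieldNormedType.Exports.
Local Open Scope classical_set_scope.
Local Open Scope ring_scope.
Local Open Scope complex_scope.

(** * Linear algebra of Lagrangian frames *)

Lemma sum_I2 (V : nmodType) (f : 'I_2 -> V) : \sum_k f k = f 0 + f 1.
Proof.
rewrite big_ord_recl big_ord1; congr (f _ + f _); exact/val_inj.
Qed.

Lemma I2_cases (k : 'I_2) : k = 0 \/ k = 1.
Proof. by case: k => -[|[|//]] lt; [left|right]; apply/val_inj. Qed.

Section LinearAlgebra.
Context {R : realType}.
Implicit Types (X Y Z A B : TR2 R).

Lemma OmegaE X Y : Omega X Y = X.2 0 0 * Y.1 0 0 - X.1 0 0 * Y.2 0 0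
  + (X.2 0 1 * Y.1 0 1 - X.1 0 1 * Y.2 0 1).
Proof. by rewrite /Omega sum_I2. Qed.

Lemma GGE X Y : GG X Y = X.2 0 0 * Y.1 0 1 - X.1 0 0 * Y.2 0 1
  - (X.2 0 1 * Y.1 0 0 - X.1 0 1 * Y.2 0 0).
Proof. by rewrite /GG OmegaE /JJ /jrot !mxE /=; ring. Qed.

Lemma OmegaC X Y : Omega X Y = - Omega Y X.
Proof. by rewrite !OmegaE; ring. Qed.

Lemma GGC X Y : GG X Y = GG Y X.
Proof. by rewrite !GGE; ring. Qed.

Lemma GG_JJl X Y : GG (JJ X) Y = - Omega X Y.
Proof. by rewrite GGE OmegaE /JJ /jrot !mxE /=; ring. Qed.

Lemma Omega_JJl X Y : Omega (JJ X) Y = GG X Y.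
Proof. by []. Qed.


Lemma OmegaDl Z X Y : Omega (X + Y) Z = Omega X Z + Omega Y Z.
Proof. by rewrite !OmegaE /= !mxE; ring. Qed.

Lemma OmegaZl Z (a : R) X : Omega (a *: X) Z = a * Omega X Z.
Proof. by rewrite !OmegaE /= !mxE; ring. Qed.

Lemma OmegaNl Z X : Omega (- X) Z = - Omega X Z.
Proof. by rewrite !OmegaE /= !mxE; ring. Qed.

Lemma GGDl Z X Y : GG (X + Y) Z = GG X Z + GG Y Z.
Proof. by rewrite !GGE /= !mxE; ring. Qed.

Lemma GGZl Z (a : R) X : GG (a *: X) Z = a * GG X Z.
Proof. by rewrite !GGE /= !mxE; ring. Qed.

Lemma GGNl Z X : GG (- X) Z = - GG X Z.
Proof. by rewrite !GGE /= !mxE; ring. Qed.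

Lemma Omega_add_eq0 X Y A B :
  Omega X Y + Omega A B = 0 -> Omega X Y = Omega B A.
Proof. by move/eqP; rewrite addr_eq0 => /eqP ->; rewrite (OmegaC A) opprK. Qed.

Lemma JJZ (a : R) X : JJ (a *: X) = a *: JJ X.
Proof.
by congr (_, _); apply/rowP => k; rewrite !mxE; case: ifP => _; rewrite ?mulrN.
Qed.

Lemma JJ0 : JJ 0 = 0 :> TR2 R.
Proof.
by rewrite -[LHS]/(JJ (0 : TR2 R)) -(scale0r (0 : TR2 R)) JJZ !scale0r.
Qed.

Lemma JJ_eq0 X : JJ X = 0 -> X = 0.
Proof.
have JJK : JJ (JJ X) = - X.
  by congr (_, _); apply/rowP => k; case: (I2_cases k) => ->;
    rewrite /= !mxE /= ?mxE.
by move=> X0; apply/eqP; rewrite -oppr_eq0 -JJK X0 JJ0.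
Qed.

(** A skew-Hermitian form, written in the complex coordinates so that determinants of its values
    factor as a polynomial identity. *)
Definition herm X Y : R[i] := w2 X * (w1 Y)^* - w1 X * (w2 Y)^*.

Lemma hermE X Y : herm X Y = Omega X Y +i* - GG X Y.
Proof.
rewrite /herm /w1 /w2 OmegaE GGE; simpc.
by apply/eqP; rewrite eq_complex /=; apply/andP; split; apply/eqP; ring.
Qed.

(** The matrix of values of [herm] is the product of the matrix with rows [(w2, - w1)] at [X], [Y]
    and the matrix with columns the conjugates of [(w1, w2)] at [A], [B]; determinants multiply. *)
Lemma herm_cauchy_binet X Y A B :
  herm X A * herm Y B - herm X B * herm Y A = dw1w2 X Y * (dw1w2 A B)^*.
Proof. by rewrite /herm /dw1w2 rmorphB !rmorphM /=; ring. Qed.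

(** Cramer's rule: the two equations are linear in [w1 Z] and [w2 Z], with determinant the conjugate
    of [dw1w2 A B]. *)
Lemma herm_eq0 A B Z : dw1w2 A B != 0 -> herm Z A = 0 -> herm Z B = 0 -> Z = 0.
Proof.
rewrite -conjc_eq0 => AB0 ZA ZB.
have h2 : w2 Z * (dw1w2 A B)^* = 0.
  rewrite (_ : _ * _ = (w2 B)^* * herm Z A - (w2 A)^* * herm Z B).
    by rewrite ZA ZB !mulr0 subrr.
  by rewrite /herm /dw1w2 rmorphB !rmorphM /=; ring.
have h1 : w1 Z * (dw1w2 A B)^* = 0.
  rewrite (_ : _ * _ = (w1 B)^* * herm Z A - (w1 A)^* * herm Z B).
    by rewrite ZA ZB !mulr0 subrr.
  by rewrite /herm /dw1w2 rmorphB !rmorphM /=; ring.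
move: h1 h2 => /eqP + /eqP; rewrite !mulf_eq0 (negPf AB0) !orbF !eq_complex /=.
case/andP=> /eqP z1 /eqP z2 /andP[/eqP z3 /eqP z4].
rewrite [Z]surjective_pairing; congr (_, _); apply/rowP => k; rewrite mxE;
  case: k => -[|[|//]] lt.
- by rewrite -[RHS]z1; congr (Z.1 _ _); apply/val_inj.
- by rewrite -[RHS]z2; congr (Z.1 _ _); apply/val_inj.
- by rewrite -[RHS]z3; congr (Z.2 _ _); apply/val_inj.
- by rewrite -[RHS]z4; congr (Z.2 _ _); apply/val_inj.
Qed.

(** Cauchy-Binet for the pair [A], [B] against itself. The sign shows that a non-degenerate induced
    metric is indefinite. *)
Lemma dw1w2_metric A B : Omega A B = 0 ->
  dw1w2 A B * (dw1w2 A B)^* = (GG A B ^+ 2 - GG A A * GG B B)%:C.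
Proof.
move=> AB; rewrite -herm_cauchy_binet !hermE (OmegaC B A) AB (GGC B A).
have O0 X : Omega X X = 0 by rewrite OmegaE; ring.
by rewrite !O0; simpc; apply/eqP; rewrite eq_complex /=; apply/andP; split;
  apply/eqP; ring.
Qed.

End LinearAlgebra.

(** Explicit entries turn contractions with the cometric into rational expressions that [field]
    settles. *)
Lemma invmx_2x2 (F : fieldType) (A : 'M[F]_2)
    (D := A 0 0 * A 1 1 - A 0 1 * A 1 0) :
  D != 0 ->
  [/\ invmx A 0 0 = A 1 1 / D, invmx A 0 1 = - A 0 1 / D,
      invmx A 1 0 = - A 1 0 / D & invmx A 1 1 = A 0 0 / D].
Proof.
move=> D0.
pose B := \matrix_(i < 2, j < 2)
  ((if i == 0 then if j == 0 then A 1 1 else - A 0 1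
    else if j == 0 then - A 1 0 else A 0 0) / D).
have AB : A *m B = 1%:M.
  apply/matrixP => i j; rewrite !mxE sum_I2 !mxE /=.
  rewrite !mulrA -mulrDl; apply/(mulIf D0); rewrite divfK //.
  case: (I2_cases i) => ->; case: (I2_cases j) => ->; rewrite /= /D.
  - by rewrite mul1r mulrN.
  - by rewrite mulrN mulrC addNr mul0r.
  - by rewrite mulrN mulrC subrr mul0r.
  - by rewrite mul1r mulrN addrC mulrC (mulrC (A 1 0)).
have [uA _] := mulmx1_unit AB.
have -> : invmx A = B by rewrite -[LHS]mulmx1 -AB mulKmx.
by split; rewrite mxE.
Qed.

(** * The mean curvature identity at a single point *)

Section Frame.
(** [e] stands for the coordinate frame, [S a b] for the second derivatives of the parametrization
    and [dh] for the partial derivatives of the angle, so that only algebra remains. *)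
Context {R : realType} (e : 'I_2 -> TR2 R) (S : 'I_2 -> 'I_2 -> TR2 R).
Context (dh : 'I_2 -> R).
Let theta := dw1w2 (e 0) (e 1).
Let g : 'M[R]_2 := \matrix_(a, b) GG (e a) (e b).
Let tang Z := \sum_a \sum_b (invmx g a b * GG Z (e a)) *: e b.
Let nor Z := Z - tang Z.

Hypothesis lag : Omega (e 0) (e 1) = 0.
Hypothesis theta0 : theta != 0.

Let D := GG (e 0) (e 0) * GG (e 1) (e 1) - GG (e 0) (e 1) ^+ 2.

Lemma Omega_frame a b : Omega (e a) (e b) = 0.
Proof.
case: (I2_cases a) => ->; case: (I2_cases b) => -> //; last first.
- by rewrite OmegaE; ring.
- by rewrite OmegaC lag oppr0.
- by rewrite OmegaE; ring.
Qed.

Lemma det_metric : theta * theta^* = (- D)%:C.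
Proof. by rewrite dw1w2_metric // /D opprB. Qed.

Lemma det_metric_neq0 : D != 0.
Proof.
apply: contra theta0 => /eqP D0; have /eqP := det_metric.
by rewrite D0 oppr0 mulf_eq0 conjc_eq0 orbb.
Qed.

Lemma cometricE :
  [/\ invmx g 0 0 = GG (e 1) (e 1) / D,
      invmx g 0 1 = - GG (e 0) (e 1) / D,
      invmx g 1 0 = - GG (e 0) (e 1) / D &
      invmx g 1 1 = GG (e 0) (e 0) / D].
Proof.
have m a b : g a b = GG (e a) (e b) by rewrite mxE.
have := @invmx_2x2 _ g; rewrite !m (GGC (e 1) (e 0)) /D expr2.
by move=> /(_ det_metric_neq0).
Qed.

(** The hypotheses are the real and imaginary parts of [herm Z (e c) = 0]. *)
Lemma frame_eq0 Z : (forall c, Omega Z (e c) = 0) ->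
  (forall c, GG Z (e c) = 0) -> Z = 0.
Proof.
by move=> OZ GZ; apply: (herm_eq0 _ _ _ theta0); rewrite hermE OZ GZ oppr0.
Qed.

Lemma GG_normal Z c : GG (nor Z) (e c) = 0.
Proof.
have [c00 c01 c10 c11] := cometricE; have := det_metric_neq0; rewrite /D => D0.
rewrite /nor /tang !sum_I2 c00 c01 c10 c11.
rewrite !(GGDl, GGNl, GGZl).

by case: (I2_cases c) => ->; rewrite ?(GGC (e 1) (e 0)) /D; field.
Qed.

(** The tangential part is a combination of frame vectors, on which [Omega] vanishes. *)
Lemma Omega_normal Z c : Omega (nor Z) (e c) = Omega Z (e c).
Proof.
rewrite /nor /tang !sum_I2.
by rewrite !(OmegaDl, OmegaNl, OmegaZl) !Omega_frame; ring.
Qed.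

Lemma GG_gradient c :
  GG (\sum_a \sum_b (invmx g a b * dh a) *: e b) (e c) = dh c.
Proof.
have [c00 c01 c10 c11] := cometricE; have := det_metric_neq0; rewrite /D => D0.
rewrite !sum_I2 c00 c01 c10 c11 !(GGDl, GGZl).
by case: (I2_cases c) => ->; rewrite ?(GGC (e 1) (e 0)) /D; field.
Qed.

(* The hypotheses are the derivatives of [Omega (e 0) (e 1) = 0] and of
   [theta = rho * exp (i * h)]. *)
Lemma frame_mean_curvature :
  S 0 1 = S 1 0 ->
  (forall a, Omega (S a 0) (e 1) = Omega (S a 1) (e 0)) ->
  (forall a, - D * dh a =
    complex.Im ((dw1w2 (S a 0) (e 1) + dw1w2 (e 0) (S a 1)) * theta^*)) ->
  2^-1 *: (\sum_a \sum_b invmx g a b *: nor (S a b)) =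
  2^-1 *: JJ (\sum_a \sum_b (invmx g a b * dh a) *: e b).
Proof.
move=> symS dlag dhE.
(* From here on the normal projection enters only through its products with the frame. *)
have normal_Omega := Omega_normal; have normal_GG := GG_normal; clearbody nor.
have [c00 c01 c10 c11] := cometricE; have := det_metric_neq0; rewrite /D => D0.
(* Cauchy-Binet applies to each summand of the derivative of [theta] times the conjugate of [theta];
   the imaginary part is the trace of [Omega (S a b) (e c)] over [b], [c] against the adjugate of
   the metric. *)
have {}dhE a : D * dh a =
    GG (e 1) (e 1) * Omega (S a 0) (e 0) + GG (e 0) (e 0) * Omega (S a 1) (e 1)
    - GG (e 0) (e 1) * (Omega (S a 0) (e 1) + Omega (S a 1) (e 0)).
  apply: oppr_inj; rewrite -mulNr dhE mulrDl -!herm_cauchy_binet !hermE.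
  by rewrite !Omega_frame (GGC (e 1) (e 0)) /=; ring.
have dhE' a : dh a = (GG (e 1) (e 1) * Omega (S a 0) (e 0) +
    GG (e 0) (e 0) * Omega (S a 1) (e 1)
    - GG (e 0) (e 1) * (Omega (S a 0) (e 1) + Omega (S a 1) (e 0))) / D.
  by rewrite -dhE mulrAC divff // mul1r.
apply/eqP; rewrite -subr_eq0; apply/eqP; apply: frame_eq0 => c.
(* Against [Omega], both sides are half a trace of [Omega (S a b) (e c)]: over the first two slots
   for the mean curvature, over the last two for the gradient. [dlag] and [symS] identify these
   traces. *)
- rewrite !sum_I2.
  rewrite !(OmegaDl, OmegaNl, OmegaZl) Omega_JJl !(GGDl, GGZl).
  rewrite !normal_Omega.
  rewrite c00 c01 c10 c11 !dhE' symS.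
  have := dlag 0; have := dlag 1; rewrite symS => d1 d0.
  by case: (I2_cases c) => ->;
    rewrite ?(GGC (e 1) (e 0)) ?d1 ?d0 -?symS /D; field.
(* Against [GG], the left side is normal, and [GG_JJl] reduces the right side to [Omega] on tangent
   vectors. *)
- rewrite !sum_I2.
  rewrite !(GGDl, GGNl, GGZl) GG_JJl !(OmegaDl, OmegaZl).
  by rewrite !normal_GG !Omega_frame; ring.
Qed.

End Frame.

(** The squared modulus of [theta] is the natural factor when an argument is differentiated;
    [det_metric] trades it for minus the determinant of the metric. *)
Lemma mean_curvature_gradient (R : realType) (f : 'rV[R]_2 -> TR2 R)
    (h : 'rV[R]_2 -> R) (u : 'rV[R]_2)
    (e := fun a => partial a f u) (S := fun a b => partial a (partial b f) u)
    (theta := dw1w2 (e 0) (e 1)) :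
  Omega (e 0) (e 1) = 0 -> theta != 0 -> S 0 1 = S 1 0 ->
  (forall a, Omega (S a 0) (e 1) = Omega (S a 1) (e 0)) ->
  (forall a, complex.Re (theta * theta^*) * partial a h u =
    complex.Im ((dw1w2 (S a 0) (e 1) + dw1w2 (e 0) (S a 1)) * theta^*)) ->
  mean_curvature f u = 2^-1 *: JJ (gradient f h u).
Proof.
move=> lag th0 sS dlag dh.
have dh' a := etrans (congr1 (fun z => complex.Re z * partial a h u)
  (esym (@det_metric _ e lag))) (dh a).
exact: (@frame_mean_curvature _ e S (fun a => partial a h u)
  lag th0 sS dlag dh').
Qed.

(** * Mixed directional derivatives *)

Section DirectionalDerivatives.
Context {R : realType} {V : normedModType R}.
Implicit Types (g : V -> R) (x y v w : V).

Lemma is_derive_line g y v (t dg : R) :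
  is_derive (y + t *: v) v g dg ->
  is_derive t 1 (fun s : R => g (y + s *: v)) dg.
Proof.
have e : (fun h : R => h^-1 *: (g (y + (h *: 1 + t) *: v) - g (y + t *: v))) =
         (fun h : R => h^-1 *: (g (h *: v + (y + t *: v)) - g (y + t *: v))).
  apply/funext => h; congr (_ *: (g _ - _)).
  by rewrite scalerDl [h *: 1]mulr1 addrCA.
by move=> [gv <-]; apply: DeriveDef; rewrite /derivable /derive /= e.
Qed.

(** Derivability at the end points is included, which supplies continuity on the closed interval. *)
Lemma MVT_closed (f df : R -> R) (h : R) : 0 < h ->
  (forall t, 0 <= t <= h -> is_derive t 1 f (df t)) ->
  exists2 t, 0 <= t <= h & f h - f 0 = df t * h.
Proof.
move=> h0 dfE; have [||t th fE] := @MVT R f df 0 h h0.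
- by move=> t; rewrite in_itv /= => /andP[t0 th]; apply: dfE; rewrite !ltW.
- apply: derivable_within_continuous => t; rewrite in_itv /= => th.
  by have [] := dfE t th.
exists t; last by rewrite fE subr0.
by move: th; rewrite in_itv /= => /andP[? ?]; rewrite !ltW.
Qed.

Lemma near_square x v w (P : set V) : (\forall y \near x, P y) ->
  exists2 h : R, 0 < h & forall s t : R, 0 <= s <= h -> 0 <= t <= h ->
    P (x + s *: v + t *: w).
Proof.
move=> /nbhs_ballP[r /= r0 rP].
have n0 : 0 < `|v| + `|w| + 1 by rewrite ltr_wpDl // addr_ge0.
(* The [1] keeps the denominator positive even if [v] and [w] vanish; the half makes the final
   inequality strict. *)
exists (r / (`|v| + `|w| + 1) / 2) => [|s t /andP[s0 sh] /andP[t0 th]].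
  by rewrite !divr_gt0.
apply: rP; rewrite -ball_normE /ball_ /= -addrA opprD addrA subrr add0r normrN.
apply: (le_lt_trans (ler_normD _ _)); rewrite !normrZ !ger0_norm //.
set h := (X in s <= X) in sh th *.
apply: (@le_lt_trans _ _ (h * (`|v| + `|w| + 1))).
  have h0 : 0 <= h := le_trans s0 sh.
  have : s * `|v| <= h * `|v| by rewrite ler_wpM2r.
  have : t * `|w| <= h * `|w| by rewrite ler_wpM2r.
  lra.
rewrite /h mulrAC divfK ?gt_eqF //; lra.
Qed.

(** The mean value theorem is applied twice: along [v] to the difference of [g] on two opposite
    sides of the parallelogram, then along [w] to [g1]. *)
Lemma double_difference (g g1 g2 : V -> R) x v w (h : R) : 0 < h ->
  (forall s t : R, 0 <= s <= h -> 0 <= t <= h ->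
    is_derive (x + s *: v + t *: w) v g (g1 (x + s *: v + t *: w)) /\
    is_derive (x + s *: v + t *: w) w g1 (g2 (x + s *: v + t *: w))) ->
  exists s t : R, [/\ 0 <= s <= h, 0 <= t <= h &
    g (x + h *: v + h *: w) - g (x + h *: v) - (g (x + h *: w) - g x) =
    g2 (x + s *: v + t *: w) * (h * h)].
Proof.
move=> h0 dg.
have hh : 0 <= h <= h by rewrite ltW /=.
have l0h : 0 <= (0 : R) <= h by rewrite lexx ltW.
pose phi s := g (x + h *: w + s *: v) - g (x + s *: v).
pose dphi s := g1 (x + h *: w + s *: v) - g1 (x + s *: v).
have dphiP s : 0 <= s <= h -> is_derive s 1 phi (dphi s).
  move=> sh; apply: is_deriveB; apply: is_derive_line.
    by rewrite addrAC; exact: (dg s h sh hh).1.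
  by have := (dg s 0 sh l0h).1; rewrite scale0r addr0.
have [s sh phiE] := MVT_closed _ _ _ h0 dphiP.
have dpsiP t : 0 <= t <= h -> is_derive t 1
    (fun t => g1 (x + s *: v + t *: w)) (g2 (x + s *: v + t *: w)).
  by move=> th; apply: is_derive_line; exact: (dg s t sh th).2.
have [t th psiE] := MVT_closed _ _ _ h0 dpsiP.
exists s, t; split=> //.
move: phiE psiE; rewrite /phi /dphi !scale0r !addr0 => phiE psiE.
rewrite mulrA -psiE [x + s *: v + h *: w]addrAC -phiE.
by rewrite [x + h *: v + h *: w]addrAC; ring.
Qed.

(** Schwarz's theorem. The double difference is symmetric in [v] and [w], so [g12] and [g21] share a
    value, attained at two points of an arbitrarily small parallelogram; continuity concludes. *)
Lemma mixed_derivatives_eq (g g1 g2 g12 g21 : V -> R) x v w :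
  (\forall y \near x, is_derive y v g (g1 y) /\ is_derive y w g (g2 y)) ->
  (\forall y \near x, is_derive y w g1 (g12 y) /\ is_derive y v g2 (g21 y)) ->
  {for x, continuous g12} -> {for x, continuous g21} -> g12 x = g21 x.
Proof.
move=> d1 d2 /cvgrPdist_le c1 /cvgrPdist_le c2.
apply/eqP; rewrite -subr_eq0 -normr_le0.
apply/ler_addgt0Pl => e e0; rewrite addr0.
have e2 : 0 < e / 2 by rewrite divr_gt0.
have [h h0 Ph] := @near_square x v w _
  (filterI (filterI d1 d2) (filterI (c1 _ e2) (c2 _ e2))).
have [s t sh th|s [t [sh th E]]] := @double_difference g g1 g12 x v w h h0.
  by have [[[p _] [q _]] _] := Ph s t sh th; split; [exact: p|exact: q].
have [t0 s0 th0 sh0|t' [s' [th' sh' E']]] :=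
    @double_difference g g2 g21 x w v h h0.
  rewrite addrAC.
  by have [[[_ p] [_ q]] _] := Ph s0 t0 sh0 th0; split; [exact: p|exact: q].
have EE : g12 (x + s *: v + t *: w) = g21 (x + s' *: v + t' *: w).
  apply: (@mulIf _ (h * h)); first by rewrite mulf_neq0 // gt_eqF.
  rewrite -E [x + s' *: v + _]addrAC -E' [x + h *: v + _]addrAC.
  by move: (g _) (g _) (g _) (g _) => *; ring.
have [_ [b _]] := Ph _ _ sh th; have [_ [_ b']] := Ph _ _ sh' th'.
move: b b' => /=; rewrite EE; move: (g12 x) (g21 x) (g21 _) => A B C b b'.
have -> : A - B = (A - C) - (B - C) by ring.
by apply: le_trans (ler_normB _ _) _; rewrite [e]splitr lerD.
Qed.

Lemma is_derive_linear_comp (W W' : normedModType R) (c : {linear W -> W'})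
    (f : V -> W) x v : continuous c ->
  differentiable f x -> is_derive x v (c \o f) (c ('D_v f x)).
Proof.
move=> cc df; have dc := linear_differentiable (f x) cc.
have dcf : differentiable (c \o f) x by exact: differentiable_comp.
apply: DeriveDef; first exact: diff_derivable.
by rewrite (deriveE _ df) (deriveE _ dcf) (diff_comp df dc) diff_lin.
Qed.

End DirectionalDerivatives.

(** * Derivatives of [Omega] and [dw1w2] through real coordinates *)

Section CoordinateForms.
Context {R : realType}.

(** The coordinates are named so that they can carry the linear structure that
    [is_derive_linear_comp] expects. *)
Definition coord1 (k : 'I_2) (X : TR2 R) : R := X.1 0 k.
Definition coord2 (k : 'I_2) (X : TR2 R) : R := X.2 0 k.

Fact coord1_linear k : linear (coord1 k).
Proof. by move=> a X Y; rewrite /coord1 /= !mxE. Qed.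
Fact coord2_linear k : linear (coord2 k).
Proof. by move=> a X Y; rewrite /coord2 /= !mxE. Qed.

HB.instance Definition _ k :=
  GRing.isLinear.Build R (TR2 R) R _ (coord1 k) (coord1_linear k).
HB.instance Definition _ k :=
  GRing.isLinear.Build R (TR2 R) R _ (coord2 k) (coord2_linear k).

Lemma coord1_continuous k : continuous (coord1 k).
Proof.
move=> X; apply: (@continuous_comp _ _ _ fst (fun M : 'rV[R]_2 => M 0 k)).
  exact: cvg_fst.
exact: coord_continuous.
Qed.

Lemma coord2_continuous k : continuous (coord2 k).
Proof.
move=> X; apply: (@continuous_comp _ _ _ snd (fun M : 'rV[R]_2 => M 0 k)).
  exact: cvg_snd.
exact: coord_continuous.
Qed.

Lemma TR2_eq (X Y : TR2 R) : (forall k, coord1 k X = coord1 k Y) ->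
  (forall k, coord2 k X = coord2 k Y) -> X = Y.
Proof.
case: X Y => [X1 X2] [Y1 Y2] h1 h2.
by congr (_, _); apply/rowP => k; [exact: h1|exact: h2].
Qed.

Context {V : normedModType R}.
Implicit Types (F G : V -> TR2 R) (u v : V).

Lemma is_derive_coord1 k F u v : differentiable F u ->
  is_derive u v (fun y => (F y).1 0 k) (('D_v F u).1 0 k).
Proof.
exact: (is_derive_linear_comp _ _ (coord1 k) _ _ _ (coord1_continuous k)).
Qed.

Lemma is_derive_coord2 k F u v : differentiable F u ->
  is_derive u v (fun y => (F y).2 0 k) (('D_v F u).2 0 k).
Proof.
exact: (is_derive_linear_comp _ _ (coord2 k) _ _ _ (coord2_continuous k)).
Qed.

Lemma is_derive_Omega F G u v : differentiable F u -> differentiable G u ->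
  is_derive u v (fun y => Omega (F y) (G y))
    (Omega ('D_v F u) (G u) + Omega (F u) ('D_v G u)).
Proof.
move=> dF dG.
have -> : (fun y => Omega (F y) (G y)) = (fun y =>
  ((F y).2 0 0 * (G y).1 0 0 - (F y).1 0 0 * (G y).2 0 0)
  + ((F y).2 0 1 * (G y).1 0 1 - (F y).1 0 1 * (G y).2 0 1)).
  by apply/funext => y; rewrite OmegaE.
have dF1 k := is_derive_coord1 k F u v dF.
have dF2 k := is_derive_coord2 k F u v dF.
have dG1 k := is_derive_coord1 k G u v dG.
have dG2 k := is_derive_coord2 k G u v dG.
move: dF1 dF2 dG1 dG2; move: ('D_v F u) ('D_v G u) => F' G' dF1 dF2 dG1 dG2.
(* Instance resolution assembles a derivative from the coordinate derivatives in the context; what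
   remains is to compare it with the claimed one. *)
apply: is_derive_eq.
by rewrite !OmegaE /GRing.scale /=; ring.
Qed.

Lemma dw1w2E (X Y : TR2 R) : dw1w2 X Y =
  (X.1 0 0 * Y.2 0 0 - X.1 0 1 * Y.2 0 1
   - (X.2 0 0 * Y.1 0 0 - X.2 0 1 * Y.1 0 1))
  +i* (X.1 0 0 * Y.2 0 1 + X.1 0 1 * Y.2 0 0
       - (X.2 0 0 * Y.1 0 1 + X.2 0 1 * Y.1 0 0)).
Proof. by rewrite /dw1w2 /w1 /w2; simpc. Qed.

Lemma is_derive_Re_dw1w2 F G u v : differentiable F u -> differentiable G u ->
  is_derive u v (fun y => complex.Re (dw1w2 (F y) (G y)))
    (complex.Re (dw1w2 ('D_v F u) (G u) + dw1w2 (F u) ('D_v G u))).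
Proof.
move=> dF dG.
have -> : (fun y => complex.Re (dw1w2 (F y) (G y))) = (fun y =>
  (F y).1 0 0 * (G y).2 0 0 - (F y).1 0 1 * (G y).2 0 1
  - ((F y).2 0 0 * (G y).1 0 0 - (F y).2 0 1 * (G y).1 0 1)).
  by apply/funext => y; rewrite dw1w2E.
have dF1 k := is_derive_coord1 k F u v dF.
have dF2 k := is_derive_coord2 k F u v dF.
have dG1 k := is_derive_coord1 k G u v dG.
have dG2 k := is_derive_coord2 k G u v dG.
move: dF1 dF2 dG1 dG2; move: ('D_v F u) ('D_v G u) => F' G' dF1 dF2 dG1 dG2.
apply: is_derive_eq.
by rewrite !dw1w2E /GRing.scale /=; ring.
Qed.

Lemma is_derive_Im_dw1w2 F G u v : differentiable F u -> differentiable G u ->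
  is_derive u v (fun y => complex.Im (dw1w2 (F y) (G y)))
    (complex.Im (dw1w2 ('D_v F u) (G u) + dw1w2 (F u) ('D_v G u))).
Proof.
move=> dF dG.
have -> : (fun y => complex.Im (dw1w2 (F y) (G y))) = (fun y =>
  (F y).1 0 0 * (G y).2 0 1 + (F y).1 0 1 * (G y).2 0 0
  - ((F y).2 0 0 * (G y).1 0 1 + (F y).2 0 1 * (G y).1 0 0)).
  by apply/funext => y; rewrite dw1w2E.
have dF1 k := is_derive_coord1 k F u v dF.
have dF2 k := is_derive_coord2 k F u v dF.
have dG1 k := is_derive_coord1 k G u v dG.
have dG2 k := is_derive_coord2 k G u v dG.
move: dF1 dF2 dG1 dG2; move: ('D_v F u) ('D_v G u) => F' G' dF1 dF2 dG1 dG2.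
apply: is_derive_eq.
by rewrite !dw1w2E /GRing.scale /=; ring.
Qed.

Lemma differentiable_coord1 k F u : differentiable F u ->
  differentiable (fun y => (F y).1 0 k) u.
Proof.
move=> dF; apply: (@differentiable_comp _ _ _ _ F (coord1 k)) => //.
exact: linear_differentiable (coord1_continuous k).
Qed.

Lemma differentiable_coord2 k F u : differentiable F u ->
  differentiable (fun y => (F y).2 0 k) u.
Proof.
move=> dF; apply: (@differentiable_comp _ _ _ _ F (coord2 k)) => //.
exact: linear_differentiable (coord2_continuous k).
Qed.

Lemma differentiable_Re_dw1w2 F G u :
  differentiable F u -> differentiable G u ->
  differentiable (fun y => complex.Re (dw1w2 (F y) (G y))) u.
Proof.
move=> dF dG; rewrite (_ : (fun y => _) = (fun y =>
  (F y).1 0 0 * (G y).2 0 0 - (F y).1 0 1 * (G y).2 0 1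
  - ((F y).2 0 0 * (G y).1 0 0 - (F y).2 0 1 * (G y).1 0 1))).
  by apply: differentiableB; apply: differentiableB; apply: differentiableM;
    first [exact: differentiable_coord1|exact: differentiable_coord2].
by apply/funext => y; rewrite dw1w2E.
Qed.

Lemma differentiable_Im_dw1w2 F G u :
  differentiable F u -> differentiable G u ->
  differentiable (fun y => complex.Im (dw1w2 (F y) (G y))) u.
Proof.
move=> dF dG; rewrite (_ : (fun y => _) = (fun y =>
  (F y).1 0 0 * (G y).2 0 1 + (F y).1 0 1 * (G y).2 0 0
  - ((F y).2 0 0 * (G y).1 0 1 + (F y).2 0 1 * (G y).1 0 0))).
  by apply: differentiableB; apply: differentiableD; apply: differentiableM;
    first [exact: differentiable_coord1|exact: differentiable_coord2].
by apply/funext => y; rewrite dw1w2E.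
Qed.

Lemma mixed_derivatives_eq_TR2 F u v w (U : set V) : open U -> U u ->
  smooth_on U F -> 'D_w ('D_v F) u = 'D_v ('D_w F) u.
Proof.
move=> oU Uu sF.
have dF y : U y -> differentiable F y by move=> Uy; have [/(_ y Uy)] := sF 1%N.
have d1 z y : U y -> differentiable ('D_z F) y.
  by move=> Uy; have [_ /(_ z)[/(_ y Uy)]] := sF 2%N.
(* Order three makes the second derivatives differentiable, hence continuous. *)
have d2 z t y : U y -> differentiable ('D_t ('D_z F)) y.
  by move=> Uy; have [_ /(_ z)[_ /(_ t)[/(_ y Uy)]]] := sF 3%N.
have key (c : {linear TR2 R -> R}) : continuous c ->
    c ('D_w ('D_v F) u) = c ('D_v ('D_w F) u).
  move=> cc.
  apply: (@mixed_derivatives_eq _ _ (c \o F) (c \o 'D_v F) (c \o 'D_w F)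
    (c \o 'D_w ('D_v F)) (c \o 'D_v ('D_w F)) u v w).
  - near=> y.
    have Uy : U y by near: y; exact: open_nbhs_nbhs.
    by split; apply: is_derive_linear_comp => //; exact: dF.
  - near=> y.
    have Uy : U y by near: y; exact: open_nbhs_nbhs.
    by split; apply: is_derive_linear_comp => //; exact: d1.
  - apply: continuous_comp; last exact: cc.
    exact: differentiable_continuous (d2 _ _ _ Uu).
  - apply: continuous_comp; last exact: cc.
    exact: differentiable_continuous (d2 _ _ _ Uu).
apply: TR2_eq => k; apply: key;
  [exact: coord1_continuous|exact: coord2_continuous].
Unshelve. all: by end_near. Qed.

End CoordinateForms.

(** * Spans of two vectors and calculus on the parameter plane *)

Section Plane.
Context {R : realType}.

Lemma span2P (W : vectType R) (x y z : W) :
  reflect (exists a b : R, z = a *: x + b *: y) (z \in <<[:: x; y]>>%VS).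
Proof.
rewrite span_cons span_seq1; apply: (iffP memv_addP) => [|[a [b ->]]].
  by move=> [_ /vlineP[a ->] [_ /vlineP[b ->] ->]]; exists a, b.
exists (a *: x); first by rewrite memvZ ?memv_line.
by exists (b *: y); rewrite ?memvZ ?memv_line.
Qed.

Lemma mem_span2l (W : vectType R) (x y : W) : x \in <<[:: x; y]>>%VS.
Proof. by rewrite memv_span // mem_head. Qed.

Lemma mem_span2r (W : vectType R) (x y : W) : y \in <<[:: x; y]>>%VS.
Proof. by rewrite memv_span // !inE eqxx orbT. Qed.

Lemma free2_eq0 (W : vectType R) (x y : W) (a b : R) :
  free [:: x; y] -> a *: x + b *: y = 0 -> a = 0 /\ b = 0.
Proof.
rewrite free_cons seq1_free span_seq1 => /andP[xy y0] E.
have a0 : a = 0.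
  apply/eqP/negPn/negP => a0; case/negP: xy.
  apply/vlineP; exists (- (a^-1 * b)).
  apply: (scalerI a0); rewrite scalerA mulrN mulrA divff // mul1r scaleNr.
  by apply/eqP; rewrite -addr_eq0 E.
split=> //; move/eqP: E.
by rewrite a0 scale0r add0r scaler_eq0 (negPf y0) orbF => /eqP.
Qed.

Lemma diff_partial (W : normedModType R) (f : 'rV[R]_2 -> W) u (w : 'rV[R]_2) :
  differentiable f u ->
  'd f u w = w 0 0 *: partial 0 f u + w 0 1 *: partial 1 f u.
Proof.
move=> df; rewrite /partial !(deriveE _ df) [w in LHS]row_sum_delta sum_I2.
by rewrite linearD !linearZ.
Qed.

Lemma is_derive_comp_scalar (V : normedModType R) (h : V -> R) (f : R -> R)
    u v (df : R) :
  differentiable h u -> is_derive (h u) 1 f df ->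
  is_derive u v (fun y => f (h y)) (df * 'D_v h u).
Proof.
move=> dh [f1 <-]; have dF : differentiable f (h u) by apply/derivable1_diffP.
have dfh : differentiable (f \o h) u by exact: differentiable_comp.
apply: (@DeriveDef _ _ _ _ _ (f \o h)); first exact: diff_derivable.
rewrite (deriveE _ dfh) (diff_comp dh dF) /=.
by rewrite deriv1E // derive1E (deriveE _ dh) mulrC.
Qed.

(** A ball contains the segment from its centre [u] to [y], and along it the mean value theorem
    meets only zero derivatives. *)
Lemma locally_constant_of_partials (h : 'rV[R]_2 -> R) u :
  (\forall y \near u, differentiable h y /\ forall a, partial a h y = 0) ->
  \forall y \near u, h y = h u.
Proof.
move=> /nbhs_ballP[r /= r0 rP]; apply/nbhs_ballP; exists r => //= y uy.
have [t /andP[t0 t1]|t _] := MVT_closed (fun t => h (u + t *: (y - u)))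
  (fun=> 0) 1 ltr01; last first.
  rewrite mul0r scale1r scale0r addr0 [u + _]addrC subrK => /eqP.
  by rewrite subr_eq0 => /eqP.
have [|dh h0] := rP (u + t *: (y - u)).
  move: uy; rewrite -ball_normE /ball_ /= opprD addrA subrr add0r normrN.
  rewrite normrZ ger0_norm // -normrN opprB; apply: le_lt_trans.
  by rewrite ler_piMl.
apply: is_derive_line; apply: DeriveDef; first exact: diff_derivable.
by rewrite (deriveE _ dh) (diff_partial _ _ _ _ dh) !h0 !scaler0 addr0.
Qed.

End Plane.

(** * The Lagrangian angle *)

(** If [dw1w2 A B] vanishes, the Gram matrix is singular. Its kernel vector
    [GG A B *: A - GG A A *: B] must be zero, so by freeness [A] is orthogonal to the whole plane,
    hence zero: a contradiction. *)
Lemma dw1w2_frame_neq0 (R : realType) (A B : TR2 R) : Omega A B = 0 ->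
  free [:: A; B] ->
  (forall X, X \in <<[:: A; B]>>%VS ->
    (forall Y, Y \in <<[:: A; B]>>%VS -> GG X Y = 0) -> X = 0) ->
  dw1w2 A B != 0.
Proof.
move=> AB fAB nn; apply/negP => /eqP th0.
have D0 : GG A B ^+ 2 - GG A A * GG B B = 0.
  have := dw1w2_metric _ _ AB.
  by rewrite th0 mul0r => /(congr1 (@complex.Re R)).
have ortho X : X \in <<[:: A; B]>>%VS -> GG X A = 0 -> GG X B = 0 -> X = 0.
  move=> Xin XA XB; apply: nn => // Y /span2P[a [b ->]].
  by rewrite GGC GGDl !GGZl ![GG _ X]GGC XA XB !mulr0 addr0.
have [|gAB /eqP] := free2_eq0 _ _ _ (GG A B) (- GG A A) fAB.
  apply: ortho; first by apply/span2P; exists (GG A B), (- GG A A).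
    by rewrite GGDl !GGZl (GGC B A); ring.
  by rewrite GGDl !GGZl -[RHS]D0; ring.
rewrite oppr_eq0 => /eqP AA.
have A0 : A = 0.
  by apply: ortho => //; exact: mem_span2l.
have := free2_eq0 _ _ _ 1 0 fAB.
by rewrite A0 scaler0 scale0r addr0 => /(_ erefl) [/eqP]; rewrite oner_eq0.
Qed.

Section Angle.
Context {R : realType}.

(** [acos] only reaches the upper half plane, so its sign is flipped for a negative imaginary
    part. *)
Lemma arg_exists (z : R[i]) : z != 0 ->
  exists b r : R, 0 < r /\ z = r%:C * (cos b +i* sin b).
Proof.
case: z => x y z0; pose r := Num.sqrt (x ^+ 2 + y ^+ 2).
have n0 : 0 < x ^+ 2 + y ^+ 2.
  rewrite lt0r addr_ge0 ?sqr_ge0 // andbT paddr_eq0 ?sqr_ge0 // !sqrf_eq0.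
  by apply: contra z0 => /andP[/eqP -> /eqP ->].
have r0 : 0 < r by rewrite sqrtr_gt0.
have r2 : r ^+ 2 = x ^+ 2 + y ^+ 2 by rewrite sqr_sqrtr // ltW.
have xr : -1 <= x / r <= 1.
  rewrite -ler_norml normrM normfV (gtr0_norm r0) ler_pdivrMr // mul1r.
  by rewrite -sqrtr_sqr ler_wsqrtr // lerDl sqr_ge0.
have sE : sin (acos (x / r)) = `|y| / r.
  rewrite sin_acos // (_ : 1 - _ = (y / r) ^+ 2).
    by rewrite sqrtr_sqr normrM normfV (gtr0_norm r0).
  rewrite !expr_div_n -[1](@divff _ (r ^+ 2)) ?expf_neq0 ?gt_eqF // -mulrBl r2.
  by rewrite [_ + y ^+ 2]addrC addrK.
exists (if 0 <= y then acos (x / r) else - acos (x / r)), r; split=> //.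
have cE : cos (acos (x / r)) = x / r by rewrite acosK // in_itv.
have rK t : r * (t / r) = t by rewrite mulrC divfK ?gt_eqF.
apply/eqP; simpc; rewrite eq_complex /=; case: (leP 0 y) => y0.
  by rewrite cE sE ger0_norm // !rK !eqxx.
by rewrite cosN sinN cE sE ltr0_norm // mulNr opprK !rK !eqxx.
Qed.

(** [c] and [s] are the real and imaginary parts of [z] rotated by the angle [- b]. In the right
    half plane the argument is [atan (s / c)], which varies differentiably with [z]. *)
Lemma arg_atan (z : R[i]) (b : R)
    (c := complex.Re z * cos b + complex.Im z * sin b)
    (s := complex.Im z * cos b - complex.Re z * sin b) : 0 < c ->
  exists2 r : R, 0 < r &
    z = r%:C * (cos (b + atan (s / c)) +i* sin (b + atan (s / c))).
Proof.
move=> c0; set a := atan (s / c).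
have ca : 0 < cos a.
  by rewrite /a cos_atan invr_gt0 sqrtr_gt0 ltr_wpDr ?sqr_ge0.
exists (c / cos a); first by rewrite divr_gt0.
have sa : sin a = s / c * cos a.
  by rewrite -[s / c](atanK) -/a /tan divfK // gt_eqF.
have cs : c / cos a * sin a = s.
  by rewrite sa mulrACA mulVf ?gt_eqF // mulr1 mulrC divfK ?gt_eqF.
have cc : c / cos a * cos a = c by rewrite divfK // gt_eqF.
rewrite cosD sinD; simpc; apply/eqP; rewrite eq_complex /=.
have b1 := cos2Dsin2 b; rewrite !mulrDr !mulrN; apply/andP; split; apply/eqP.
- rewrite mulrCA cc mulrCA cs /c /s -[LHS]mulr1 -b1; ring.
- rewrite mulrCA cc mulrCA cs /c /s -[LHS]mulr1 -b1; ring.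
Qed.

(** The hypothesis says that [(X, Y)] is parallel to [(cos h, sin h)], in either direction, as suits
    an angle modulo pi. Differentiating it gives the usual derivative of an argument. *)
Lemma phase_derivative (X Y h : 'rV[R]_2 -> R) (u v : 'rV[R]_2) (dX dY : R) :
  differentiable h u -> is_derive u v X dX -> is_derive u v Y dY ->
  (\forall y \near u, sin (h y) * X y = cos (h y) * Y y) ->
  (X u ^+ 2 + Y u ^+ 2) * 'D_v h u = dY * X u - dX * Y u.
Proof.
move=> dh DX DY E.
have Ds := is_derive_comp_scalar _ _ sin u v _ dh (is_derive_sin (h u)).
have Dc := is_derive_comp_scalar _ _ cos u v _ dh (is_derive_cos (h u)).
have L := is_deriveM Ds DX; have Q := is_deriveM Dc DY.
have e1 := @derive_val _ _ _ _ _ _ _ L; have e2 := @derive_val _ _ _ _ _ _ _ Q.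
have e3 := near_eq_derive v E.
have Eu : sin (h u) * X u = cos (h u) * Y u := nbhs_singleton E.
have {e1 e2 e3} : sin (h u) * dX + X u * (cos (h u) * 'D_v h u) =
    cos (h u) * dY + Y u * (- sin (h u) * 'D_v h u).
  exact: (etrans (esym e1) (etrans e3 e2)).
move: Eu (cos2Dsin2 (h u)).
move: (sin (h u)) (cos (h u)) (X u) (Y u) ('D_v h u).
move=> s c x y d xy cs eq.
(* The signed length: [(x, y)] is [r] times the unit vector [(c, s)]. *)
pose r := c * x + s * y.
have xE : x = r * c.
  transitivity (x * (c ^+ 2 + s ^+ 2)); first by rewrite cs mulr1.
  rewrite /r; transitivity (c ^+ 2 * x + s * (s * x)); first ring.
  by rewrite xy; ring.
have yE : y = r * s.
  transitivity (y * (c ^+ 2 + s ^+ 2)); first by rewrite cs mulr1.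
  rewrite /r; transitivity (c * (c * y) + s ^+ 2 * y); first ring.
  by rewrite -xy; ring.
have : r * d = c * dY - s * dX.
  transitivity (d * (c * x + s * y)); first by rewrite mulrC.
  transitivity ((s * dX + x * (c * d)) - s * dX + s * y * d); first ring.
  by rewrite eq; ring.
move=> rd; transitivity (r * (r * d) * (c ^+ 2 + s ^+ 2)).
  by rewrite xE yE; ring.
by rewrite cs rd mulr1 xE yE; ring.
Qed.

(** Used with [w] the derivative of [z], to pass from the real formula for the derivative of an
    argument to the complex one. *)
Lemma Re_Im_mul_conjc (z w : R[i]) (d : R) :
  (complex.Re z ^+ 2 + complex.Im z ^+ 2) * d =
    complex.Im w * complex.Re z - complex.Re w * complex.Im z ->
  complex.Re (z * z^*) * d = complex.Im (w * z^*).
Proof.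
case: z w => [x y] [a b] /= E; rewrite mulrN opprK -!expr2 E; ring.
Qed.

End Angle.

(** * Immersed surfaces *)

Section Charts.
Context {R : realType} {M : surface R}.
Implicit Types (p q : M) (i j : atlas M).

Lemma near_par i p (P : set M) : dom i p -> (\forall q \near p, P q) ->
  \forall y \near chart i p, P (par i y).
Proof.
by move=> dp Pp; apply: (par_continuous dp); rewrite chartK.
Qed.

Lemma near_chart i p (P : set 'rV[R]_2) : dom i p ->
  (\forall y \near chart i p, P y) -> \forall q \near p, P (chart i q).
Proof. by move=> dp; apply: (chart_continuous dp). Qed.

Lemma near_dom i p : dom i p -> \forall q \near p, dom i q.
Proof. by move=> dp; apply: open_nbhs_nbhs; split=> //; exact: dom_open. Qed.

Lemma near_chart_image i p : dom i p ->
  \forall y \near chart i p, (chart i @` dom i) y.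
Proof.
by move=> dp; apply: open_nbhs_nbhs; split; [exact: chart_open|exists p].
Qed.

Lemma parK i y : (chart i @` dom i) y ->
  dom i (par i y) /\ chart i (par i y) = y.
Proof. by move=> [p dp <-]; rewrite chartK. Qed.

Lemma differentiable_transition i j p : dom i p -> dom j p ->
  differentiable (chart j \o par i) (chart i p).
Proof.
move=> dip djp; have [+ _] := @transition_smooth _ M i j 1%N.
by apply; exists p.
Qed.

End Charts.

(** * The angle and the mean curvature of an immersed surface *)

Section Immersion.
Context {R : realType} {M : surface R} {F : M -> TR2 R}.
Hypothesis immF : immersion F.
Implicit Types (p q : M) (i j : atlas M).

Lemma immersion_differentiable i p : dom i p ->
  differentiable (F \o par i) (chart i p).
Proof. by move=> dp; have [/(_ 1%N)[+ _] _] := immF i; apply; exists p. Qed.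

Lemma immersion_partial_differentiable i p a : dom i p ->
  differentiable (partial a (F \o par i)) (chart i p).
Proof.
move=> dp; have [/(_ 2%N)[_ /(_ (delta_mx 0 a))[+ _]] _] := immF i.
by apply; exists p.
Qed.

Lemma partial_comm i p : dom i p ->
  partial 0 (partial 1 (F \o par i)) (chart i p) =
  partial 1 (partial 0 (F \o par i)) (chart i p).
Proof.
move=> dp; have [sF _] := immF i.
apply: (mixed_derivatives_eq_TR2 _ _ _ _ (chart i @` dom i)) => //.
exact: chart_open.
Qed.

(** Near the point, [F \o par i] factors through [F \o par j] by the transition map, and the chain
    rule puts its partials in the other span. *)
Lemma tangent_at_sub i j p : dom i p -> dom j p ->
  (tangent_at F i p <= tangent_at F j p)%VS.
Proof.
move=> dip djp.
have tau := differentiable_transition _ _ _ dip djp.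
have tauE : (chart j \o par i) (chart i p) = chart j p by rewrite /= chartK.
have dj : differentiable (F \o par j) ((chart j \o par i) (chart i p)).
  by rewrite tauE; exact: immersion_differentiable.
have E : \forall y \near chart i p,
    (F \o par i) y = ((F \o par j) \o (chart j \o par i)) y.
  have := near_par _ _ _ dip (near_dom _ _ djp).
  by apply: filterS => y djy /=; rewrite chartK.
have key a : partial a (F \o par i) (chart i p) \in tangent_at F j p.
  rewrite /partial (near_eq_derive _ E).
  have dcomp := differentiable_comp tau dj.
  rewrite (deriveE _ dcomp) (diff_comp tau dj) /=.
  rewrite -/((chart j \o par i) (chart i p)) tauE.
  rewrite (diff_partial _ _ _ _ (immersion_differentiable _ _ djp)).
  by apply/span2P; eexists; eexists; reflexivity.
apply/subvP => _ /span2P[a [b ->]].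
by rewrite memvD // memvZ.
Qed.

Hypothesis lagF : lagrangian F.

Lemma partial_Omega i p : dom i p ->
  Omega (partial 0 (F \o par i) (chart i p))
        (partial 1 (F \o par i) (chart i p)) = 0.
Proof.
by move=> dp; exact: (lagF i p dp _ _ (mem_span2l _ _ _) (mem_span2r _ _ _)).
Qed.

(** The Lagrangian condition holds on the whole open image of the chart, so it can be differentiated
    there. *)
Lemma derivative_lagrangian i p a : dom i p ->
  Omega (partial a (partial 0 (F \o par i)) (chart i p))
        (partial 1 (F \o par i) (chart i p)) =
  Omega (partial a (partial 1 (F \o par i)) (chart i p))
        (partial 0 (F \o par i) (chart i p)).
Proof.
move=> dp.
have d0 := immersion_partial_differentiable i p 0 dp.
have d1 := immersion_partial_differentiable i p 1 dp.
have /@derive_val E := is_derive_Omega _ _ _ (delta_mx 0 a) d0 d1.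
have Z : \forall y \near chart i p,
    Omega (partial 0 (F \o par i) y) (partial 1 (F \o par i) y) = cst 0 y.
  apply: filterS (near_chart_image i p dp) => _ [q dq <-] /=.
  exact: partial_Omega.
have := near_eq_derive (delta_mx 0 a) Z; rewrite derive_cst E.
exact: Omega_add_eq0.
Qed.

Hypothesis nnF : non_null F.

Definition theta i (y : 'rV[R]_2) : R[i] :=
  dw1w2 (partial 0 (F \o par i) y) (partial 1 (F \o par i) y).

Lemma theta_neq0 i p : dom i p -> theta i (chart i p) != 0.
Proof.
move=> dp; apply: dw1w2_frame_neq0; first exact: partial_Omega.
  exact: (immF i).2.
exact: (nnF i p dp).
Qed.

(** A change of tangent basis multiplies [dw1w2] by a real determinant, so the phase of angle [b]
    and [theta] are real multiples of each other, of either sign. *)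
Lemma angle_value_theta i p b : dom i p -> angle_value F p b ->
  sin b * complex.Re (theta i (chart i p)) =
  cos b * complex.Im (theta i (chart i p)).
Proof.
move=> dip [j [e1 [e2 [r [djp /andP[/eqP be _] r0 E]]]]].
have /subvP sub := tangent_at_sub _ _ _ djp dip; rewrite -be in sub.
have /span2P[a1 [b1 e1E]] := sub _ (mem_span2l _ e1 e2).
have /span2P[a2 [b2 e2E]] := sub _ (mem_span2r _ e1 e2).
have : dw1w2 e1 e2 = (a1 * b2 - b1 * a2)%:C * theta i (chart i p).
  rewrite e1E e2E /theta.
  move: (partial 0 _ _) (partial 1 _ _) => X Y.
  rewrite !dw1w2E /= !mxE; simpc; apply/eqP; rewrite eq_complex /=.
  by apply/andP; split; apply/eqP; ring.
rewrite {}E; move: (_ - _) (theta _ _) => d [x y]; simpc => -[Ex Ey] /=.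
(* The determinant is nonzero, since [cos b] and [sin b] do not vanish together. *)
have b1E := cos2Dsin2 b.
have d0 : d != 0.
  apply/eqP => d0; move: Ex Ey; rewrite d0 !mul0r => /eqP + /eqP.
  rewrite !mulf_eq0 (gt_eqF r0) /= => /eqP c0 /eqP s0.
  by move: b1E; rewrite c0 s0 !expr0n addr0 => /eqP; rewrite eq_sym oner_eq0.
apply: (mulfI d0); rewrite mulrCA -Ex [RHS]mulrCA -Ey; ring.
Qed.

Lemma angle_near_partial i p beta a : angle_near F p beta -> dom i p ->
  complex.Re (theta i (chart i p) * (theta i (chart i p))^*) *
    partial a (beta \o par i) (chart i p) =
  complex.Im ((dw1w2 (partial a (partial 0 (F \o par i)) (chart i p))
                 (partial 1 (F \o par i) (chart i p)) +
               dw1w2 (partial 0 (F \o par i) (chart i p))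
                 (partial a (partial 1 (F \o par i)) (chart i p))) *
              (theta i (chart i p))^*).
Proof.
move=> near_beta dp.
have [_ /(_ i dp) dbeta] := nbhs_singleton near_beta.
have d0 := immersion_partial_differentiable i p 0 dp.
have d1 := immersion_partial_differentiable i p 1 dp.
have dX := is_derive_Re_dw1w2 _ _ _ (delta_mx 0 a) d0 d1.
have dY := is_derive_Im_dw1w2 _ _ _ (delta_mx 0 a) d0 d1.
have := phase_derivative _ _ _ _ (delta_mx 0 a) _ _ dbeta dX dY.
have E : \forall y \near chart i p,
    sin (beta (par i y)) * complex.Re (theta i y) =
    cos (beta (par i y)) * complex.Im (theta i y).
  near=> y.
  have yi : (chart i @` dom i) y by near: y; exact: near_chart_image.
  have av : angle_value F (par i y) (beta (par i y)).
    near: y; apply: (near_par i p (fun q => angle_value F q (beta q))) => //.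
    by apply: filterS near_beta => q [].
  have [dy cy] := parK _ _ yi.
  by have := angle_value_theta _ _ _ dy av; rewrite cy.
by move=> /(_ E); exact: Re_Im_mul_conjc.
Unshelve. all: by end_near. Qed.

Lemma mean_curvature_gradient_at p beta i : angle_near F p beta -> dom i p ->
  mean_curvature_at F i p = 2^-1 *: JJ (gradient_at F i beta p).
Proof.
move=> near_beta dp; apply: mean_curvature_gradient.
- exact: partial_Omega.
- exact: theta_neq0.
- exact: partial_comm.
- by move=> a; exact: derivative_lagrangian.
- by move=> a; exact: angle_near_partial.
Qed.

(** Pairing a gradient with the frame recovers the partial derivatives. *)
Lemma gradient_eq0 i p (h : M -> R) a : dom i p -> gradient_at F i h p = 0 ->
  partial a (h \o par i) (chart i p) = 0.
Proof.
move=> dp grad0.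
have := @GG_gradient _ (fun a => partial a (F \o par i) (chart i p))
  (fun a => partial a (h \o par i) (chart i p)) (partial_Omega i p dp)
  (theta_neq0 i p dp) a.
rewrite -[X in GG X _]/(gradient_at F i h p) grad0 => <-.
by rewrite -(scale0r (0 : TR2 R)) GGZl mul0r.
Qed.

Lemma differentiable_Re_theta i p : dom i p ->
  differentiable (fun y => complex.Re (theta i y)) (chart i p).
Proof.
move=> dp; apply: differentiable_Re_dw1w2;
  exact: immersion_partial_differentiable.
Qed.

Lemma differentiable_Im_theta i p : dom i p ->
  differentiable (fun y => complex.Im (theta i y)) (chart i p).
Proof.
move=> dp; apply: differentiable_Im_dw1w2;
  exact: immersion_partial_differentiable.
Qed.

(** [theta] is rotated by its argument [b] at [p]. Near [p] it then stays in the right half plane,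
    where [arg_atan] gives a differentiable choice of angle. *)
Lemma angle_near_exists p : exists beta, angle_near F p beta.
Proof.
have [i dp] := dom_cover p.
have [b [r [r0 thE]]] := arg_exists _ (theta_neq0 i p dp).
pose c y := complex.Re (theta i y) * cos b + complex.Im (theta i y) * sin b.
pose s y := complex.Im (theta i y) * cos b - complex.Re (theta i y) * sin b.
pose B y := b + atan (s y / c y).
exists (B \o chart i).
have dc q : dom i q -> differentiable c (chart i q).
  move=> dq; apply: differentiableD; apply: differentiableM => //.
    exact: differentiable_Re_theta.
  exact: differentiable_Im_theta.
have ds q : dom i q -> differentiable s (chart i q).
  move=> dq; apply: differentiableB; apply: differentiableM => //.
    exact: differentiable_Im_theta.
  exact: differentiable_Re_theta.
have c0 : 0 < c (chart i p).
  rewrite /c thE; simpc; rewrite /= -!mulrA -!expr2 -mulrDr.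
  by rewrite cos2Dsin2 mulr1.
have near_c : \forall q \near p, 0 < c (chart i q).
  apply: (near_chart i p (fun y => 0 < c y)) => //.
  exact: (cvgr_gt (c (chart i p)) (differentiable_continuous (dc p dp))).
near=> q.
have dq : dom i q by near: q; exact: near_dom.
have cq : 0 < c (chart i q) by near: q.
split.
  have [rho rho0 thqE] := arg_atan _ b cq.
  exists i, (partial 0 (F \o par i) (chart i q)),
    (partial 1 (F \o par i) (chart i q)), rho; split=> //.
  by apply/andP; split; [exact: eqxx|exact: (immF i).2].
move=> j djq.
(* In another chart the angle is [B] composed with a smooth transition map. *)
have dB : differentiable B ((chart i \o par j) (chart j q)).
  have -> : (chart i \o par j) (chart j q) = chart i q by rewrite /= chartK.
  apply: differentiableD => //.
  apply: (@differentiable_comp _ _ _ _ (fun y => s y / c y) atan).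
    apply: differentiableM; first exact: ds.
    by apply: differentiableV; [exact: dc|rewrite gt_eqF].
  by apply/derivable1_diffP; exact: derivable_atan.
exact: differentiable_comp (differentiable_transition _ _ _ djq dq) dB.
Unshelve. all: by end_near. Qed.

(** Since [JJ] is injective, zero mean curvature kills the gradient of a local angle at every nearby
    point, so this angle is constant near [p]. *)
Lemma minimal_locally_constant : minimal F -> angle_locally_constant F.
Proof.
move=> minF p; have [beta near_beta] := angle_near_exists p.
have [i dp] := dom_cover p; exists (beta p).
(* Being an angle near a point is an open condition, so the curvature formula is available at all
   nearby points. *)
have near2_beta : \forall q \near p, angle_near F q beta.
  exact: nbhs_interior near_beta.
have D0 : \forall y \near chart i p, differentiable (beta \o par i) y /\
    forall a, partial a (beta \o par i) y = 0.
  near=> y.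
  have [dy cy] : dom i (par i y) /\ chart i (par i y) = y.
    by apply: parK; near: y; exact: near_chart_image.
  have nb : angle_near F (par i y) beta.
    by near: y; exact: (near_par i p (fun q => angle_near F q beta)).
  split.
    by have [_ /(_ i dy)] := nbhs_singleton nb; rewrite cy.
  move=> a; rewrite -cy; apply: gradient_eq0 => //.
  have := mean_curvature_gradient_at _ _ _ nb dy.
  rewrite (minF i _ dy) => /esym/eqP.
  rewrite scaler_eq0 invr_eq0 pnatr_eq0 /= => /eqP.
  exact: JJ_eq0.
have cst := locally_constant_of_partials _ _ D0.
have {}cst := near_chart i p _ dp cst.
near=> q.
have dq : dom i q by near: q; exact: near_dom.
have : (beta \o par i) (chart i q) = (beta \o par i) (chart i p).
  by near: q.
rewrite /= !chartK // => <-.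
suff : angle_value F q (beta q) /\
  forall i, dom i q -> differentiable (beta \o par i) (chart i q) by case.
by near: q.
Unshelve. all: by end_near. Qed.

(** The constant function [b] is itself an angle near [p], and its gradient is zero. *)
Lemma locally_constant_minimal : angle_locally_constant F -> minimal F.
Proof.
move=> lc i p dp; have [b near_b] := lc p.
have near_cst : angle_near F p (fun=> b).
  by apply: filterS near_b => q bq; split=> // j _; exact: differentiable_cst.
rewrite (mean_curvature_gradient_at _ _ _ near_cst dp).
have -> : gradient_at F i (fun=> b) p = 0.
  rewrite /gradient_at /gradient big1 // => a _; rewrite big1 // => a' _.
  by rewrite [partial a (_ \o _) _](@derive_cst _ _ _ b) mulr0 scale0r.
by rewrite JJ0 scaler0.
Qed.

End Immersion.

Theorem proposition3p1 (R : realType) (M : surface R) (F : M -> TR2 R)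
    (immF : immersion F) (lagF : lagrangian F) (nnF : non_null F) :
  [/\ (forall p : M, exists beta : M -> R, angle_near F p beta),
      (forall (p : M) (beta : M -> R), angle_near F p beta ->
         forall i : atlas M, dom i p ->
           mean_curvature_at F i p = 2^-1 *: JJ (gradient_at F i beta p))
    & minimal F <-> angle_locally_constant F].
Proof.
split.
- exact: angle_near_exists.
- by move=> p beta near_beta i dp; exact: mean_curvature_gradient_at.
- by split; [exact: minimal_locally_constant|exact: locally_constant_minimal].
Qed.
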